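(* Let $p\in(1,\infty)$, $p\neq2$. Let $G=(V,E)$ be a graph with at least six vertices and let $(G,q)$ be an infinitesimally rigid and completely full framework in $\ell^3_{2,p}$. Suppose that for every $e\in E$ the framework $(G-e,q)$ is not infinitesimally rigid. Then $G$ is $(3,4)$-tight.
   Context: $\ell^3_{2,p}$ denotes $\mathbb{R}^3$ with the norm $\|(x,y,z)\|_{2,p}=((x^2+y^2)^{p/2}+|z|^p)^{1/p}$. For a finite dimensional real normed space $X$, a rigid motion is a family $\{\alpha_x:[-1,1]\to X\}_{x\in X}$ of continuous paths with $\alpha_x(0)=x$ and $\|\alpha_x(t)-\alpha_y(t)\|=\|x-y\|$ for all $x,y,t$; if each $\alpha_x$ is differentiable at $0$, $\eta(x)=\alpha_x'(0)$ is an infinitesimal rigid motion; $\mathcal{T}(X)$ is the space of these. A framework is $(G,q)$ with $G=(V,E)$ a finite simple graph, $q\in X^V$, $q_v\neq q_w$ for $vw\in E$. An infinitesimal flex is $m\in X^V$ with $\frac{d}{dt}\big|_{t=0}\|(q_v+tm_v)-(q_w+tm_w)\|=0$ for every $vw\in E$; it is trivial if $m_v=\eta(q_v)$ for all $v$ for some $\eta\in\mathcal{T}(X)$; $(G,q)$ is infinitesimally rigid if all flexes are trivial. A set $S\subseteq X$ is full if $\eta\mapsto(\eta(s))_{s\in S}$ is injective on $\mathcal{T}(X)$; $(G,q)$ is full if $\{q_v:v\in V\}$ is full, and completely full if it is full and every subframework $(H,q|_{V(H)})$ with at least $2\dim X=6$ vertices is full. $G$ is $(3,4)$-tight if $|E|=3|V|-4$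 and $|E'|\leq3|V'|-4$ for every subgraph $(V',E')$ with at least one edge. *)

(* Defs.v *)
From mathcomp Require Import all_boot all_order all_algebra.
From mathcomp Require Import all_classical all_reals all_analysis.

Set Implicit Arguments.
Unset Strict Implicit.
Unset Printing Implicit Defensive.

Import Order.TTheory GRing.Theory Num.Theory.
Import numFieldNormedType.Exports.

Local Open Scope classical_set_scope.
Local Open Scope ring_scope.

(* [x 0 0], [x 0 1], [x 0 2] are the three coordinates of [x]; recall that
   [0 `^ r = 0] for [r != 0]. *)
Definition l2p_norm (R : realType) (p : R) (x : 'rV[R]_3) : R :=
  ((x 0 0 ^+ 2 + x 0 1 ^+ 2) `^ (p / 2) + `|x 0 2| `^ p) `^ p^-1.

(* A finite dimensional normed space is given as ['rV[R]_n] with a norm [N]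
   passed explicitly.  Continuity and differentiability of paths refer to the
   canonical topology of ['rV[R]_n]; all norms being equivalent, these are the
   notions that any norm [N] induces. *)
Section NormedSpace.
Variables (R : realType) (n : nat) (N : 'rV[R]_n -> R).

(* Only the values of [alpha x] on [-1, 1] matter. *)
Definition rigid_motion (alpha : 'rV[R]_n -> R -> 'rV[R]_n) : Prop :=
  [/\ forall x, {within `[-1, 1], continuous (alpha x)},
      forall x, alpha x 0 = x
    & forall x y t, t \in `[-1, 1] -> N (alpha x t - alpha y t) = N (x - y)].

Definition inf_rigid_motions : set ('rV[R]_n -> 'rV[R]_n) :=
  [set eta | exists2 alpha, rigid_motion alpha &
     forall x, is_derive (0 : R) (1 : R) (alpha x) (eta x)].

Definition full_set (S : set 'rV[R]_n) : Prop :=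
  forall eta1 eta2, inf_rigid_motions eta1 -> inf_rigid_motions eta2 ->
    (forall s, S s -> eta1 s = eta2 s) -> eta1 = eta2.

End NormedSpace.

(* A finite simple graph on the vertex set [V] is given by its edge set, an
   edge being the 2-element set of its endpoints. *)
Definition simple_graph (V : finType) (E : {set {set V}}) : Prop :=
  forall e, e \in E -> #|e| = 2%N.

Definition subgraph (V : finType) (E : {set {set V}})
    (W : {set V}) (F : {set {set V}}) : Prop :=
  F \subset E /\ forall e, e \in F -> e \subset W.

(* Written additively, so that no truncated subtraction is involved. *)
Definition tight34 (V : finType) (E : {set {set V}}) : Prop :=
  (#|E| + 4 = 3 * #|V|)%N /\
  forall W F, subgraph E W F -> (0 < #|F|)%N -> (#|F| + 4 <= 3 * #|W|)%N.

Section Frameworks.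
Variables (R : realType) (n : nat) (N : 'rV[R]_n -> R).
Variables (V : finType) (E : {set {set V}}) (q : V -> 'rV[R]_n).

Definition framework : Prop :=
  simple_graph E /\ forall v w, [set v; w]%SET \in E -> q v <> q w.

Definition inf_flex (m : V -> 'rV[R]_n) : Prop :=
  forall v w, [set v; w]%SET \in E ->
    is_derive (0 : R) (1 : R)
      (fun t : R => N ((q v + t *: m v) - (q w + t *: m w))) 0.

Definition trivial_flex (m : V -> 'rV[R]_n) : Prop :=
  exists2 eta, inf_rigid_motions N eta & forall v, m v = eta (q v).

Definition inf_rigid : Prop := forall m, inf_flex m -> trivial_flex m.

Definition completely_full : Prop :=
  full_set N (range q) /\
  forall W F, subgraph E W F -> (2 * n <= #|W|)%N ->
    full_set N (q @` [set` W]).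

End Frameworks.

(* Main.v *)
(** The derivative of the l_{2,p} norm at [u <> 0] is a positive multiple of an explicit
    linear form, so both infinitesimal flexes and infinitesimal rigid motions satisfy
    linear equations.  Testing those equations on vertical and horizontal pairs and then
    on the pairs [(0, u)], [(u, 2u)], [(0, 2u)], whose horizontal parts scale like [2 ^ (p
    - 1) <> 2], shows that the infinitesimal rigid motions are exactly the translations
    plus multiples of the rotation about the third axis, a space of dimension 4.  Rigidity
    then gives 3|V| <= |E| + 4.  Conversely, minimality provides for each edge a flex of
    the remaining graph that stretches this edge only; the flexes obtained from the edges
    of a subgraph, together with the 4 trivial ones, stay independent after restriction to
    a full vertex set [W], whence |F| + 4 <= 3|W|.  Fullness is available for |W| >= 6,
    and a simple graph with fewer vertices satisfies the bound anyway. *)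
Require Import Defs.
From HB Require Import structures.
From mathcomp Require Import all_boot all_order all_algebra.
From mathcomp Require Import all_classical all_reals all_analysis.
From mathcomp Require Import ring lra.
Set Implicit Arguments.
Unset Strict Implicit.
Unset Printing Implicit Defensive.
Import Order.TTheory GRing.Theory Num.Theory.
Import numFieldNormedType.Exports.
Local Open Scope ring_scope.

(** Rank-nullity: the solutions of the system [A] form a space of dimension at least [#|I| - #|J|],
    contained in a row space of rank at most [#|K|]. With [K] empty this bounds the size of an
    independent family. *)
Lemma solutions_span_leq (F : fieldType) (I J K : finType)
    (A : I -> J -> F) (B : K -> I -> F) :
  (forall x : I -> F, (forall j, \sum_i x i * A i j = 0) ->
     exists y : K -> F, forall i, x i = \sum_k y k * B k i) ->
  (#|I| <= #|J| + #|K|)%N.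
Proof.
move=> AB.
pose MA := \matrix_(i < #|I|, j < #|J|) A (enum_val i) (enum_val j).
pose MB := \matrix_(k < #|K|, i < #|I|) B (enum_val k) (enum_val i).
suff /mxrankS : (kermx MA <= MB)%MS.
  rewrite mxrank_ker leq_subLR => /leq_trans; apply.
  by rewrite leq_add ?rank_leq_col ?rank_leq_row.
apply/row_subP => r; set v := row r _.
have vA : v *m MA = 0 by rewrite -row_mul mulmx_ker row0.
case: (AB (fun i => v 0 (enum_rank i))) => [j|y vy].
  have /matrixP/(_ 0 (enum_rank j)) := vA; rewrite !mxE => vAj.
  rewrite -[RHS]vAj [LHS](reindex_onto enum_val enum_rank) /=; last first.
    by move=> i _; rewrite enum_rankK.
  apply: eq_big => [i|i _]; first by rewrite enum_valK eqxx.
  by rewrite [MA _ _]mxE enum_valK enum_rankK.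
apply/submxP; exists (\row_k y (enum_val k)); apply/rowP => i.
rewrite -[i in LHS]enum_valK vy mxE [LHS](reindex_onto enum_val enum_rank) /=; last first.
  by move=> k _; rewrite enum_rankK.
by apply: eq_big => [k|k _]; rewrite ?mxE ?enum_valK ?eqxx.
Qed.

(** * Derivatives of powers of sums of squares *)

Section DifferentiableNorm.
Local Open Scope classical_set_scope.
Variables (R : realType).
Implicit Types (f g : R -> R).

(** Both functions are $O(t)$ at 0, so the power is $O(|t|^p)$, which is $o(t)$ as $p > 1$. The
    chain rule is no help: for $p < 2$ the outer power is not differentiable at 0. *)
Lemma is_derive_pow_sumsq0 f g (p f' g' : R) : 1 < p ->
  is_derive (0 : R) (1 : R) f f' -> is_derive (0 : R) (1 : R) g g' ->
  f 0 = 0 -> g 0 = 0 ->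
  is_derive (0 : R) (1 : R) (fun t => (f t ^+ 2 + g t ^+ 2) `^ (p / 2)) 0.
Proof.
move=> p1 [df Df] [dg Dg] f0 g0.
have p20 : p / 2 != 0 by rewrite mulf_neq0 ?invr_eq0 ?pnatr_eq0// gt_eqF//; lra.
suff lim0 : (h^-1 *: (((fun t => (f t ^+ 2 + g t ^+ 2) `^ (p / 2)) \o shift 0) (h *: 1) -
    (f 0 ^+ 2 + g 0 ^+ 2) `^ (p / 2)))%R @[h --> 0^'] --> (0 : R).
  split; first by apply/cvg_ex; exists 0.
  exact: cvg_lim lim0.
have cvgq k k' : derivable k (0 : R) (1 : R) -> 'D_(1 : R) k (0 : R) = k' -> k 0 = 0 ->
    (h^-1 * k h)%R @[h --> (0:R)^'] --> (k' : R).
  move=> dk <- k0; have := dk; rewrite /derivable.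
  move=> /cvg_ex[l kl]; have <- : l = 'D_(1 : R) k (0 : R) by apply/esym/cvg_lim.
  apply: cvg_trans kl; apply: near_eq_cvg; near=> h.
  by rewrite /= k0 subr0 addr0 [h *: 1]mulr1.
have cf := cvgq _ _ df Df f0; have cg := cvgq _ _ dg Dg g0.
(* The summand 1 puts [M] strictly above the limit in [cS], hence makes it an eventual bound. *)
pose M := f' ^+ 2 + g' ^+ 2 + 1.
have M0 : 0 < M by rewrite ltr_wpDl// addr_ge0 ?sqr_ge0.
have cS : ((h^-1 * f h) ^+ 2 + (h^-1 * g h) ^+ 2)%R @[h --> (0:R)^'] --> f' ^+ 2 + g' ^+ 2.
  by rewrite !expr2; under eq_fun do rewrite !expr2; apply: cvgD; apply: cvgM.
have p10 : 0 < p - 1 by lra.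
rewrite f0 g0 expr2 mulr0 addr0 powR0//.
apply/cvgr0Pnorm_le => e e0.
near=> h.
have h0 : h != 0 by near: h; exact: nbhs_dnbhs_neq.
rewrite /= subr0 addr0 [h *: 1]mulr1.
have SM : (h^-1 * f h) ^+ 2 + (h^-1 * g h) ^+ 2 <= M.
  near: h; apply: cvgr_le; first exact: cS.
  by rewrite ltrDl.
(* The radius solves $|h|^{p-1} M^{p/2} = e$. *)
have he : `|h| <= (e / M `^ (p / 2)) `^ (p - 1)^-1.
  near: h; apply: dnbhs0_le; apply: powR_gt0; apply: divr_gt0 => //; exact: powR_gt0.
have hq : `|h| `^ p * M `^ (p / 2) <= e * `|h|.
  have -> : `|h| `^ p = `|h| `^ (p - 1) * `|h|.
    by rewrite mulrC mulr_powRB1//; lra.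
  rewrite mulrAC ler_wpM2r// -ler_pdivlMr ?powR_gt0//.
  have -> : e / M `^ (p / 2) = ((e / M `^ (p / 2)) `^ (p - 1)^-1) `^ (p - 1).
    rewrite -powRrM mulVf ?gt_eqF// powRr1// ltW// divr_gt0 ?powR_gt0//.
  by rewrite ge0_ler_powR ?nnegrE ?powR_ge0// ltW.
rewrite normrZ normfV ler_pdivrMl ?normr_gt0// [leRHS]mulrC.
apply: (le_trans _ hq).
rewrite ger0_norm ?powR_ge0//.
have -> : f h ^+ 2 + g h ^+ 2 = `|h| `^ 2 * ((h^-1 * f h) ^+ 2 + (h^-1 * g h) ^+ 2).
  rewrite (powR_mulrn 2)// real_normK ?num_real//; field.
  by rewrite h0.
rewrite powRM ?powR_ge0 ?addr_ge0 ?sqr_ge0//.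
rewrite -powRrM mulrC [2 * _]mulrC divfK ?pnatr_eq0// mulrC.
rewrite ler_wpM2l ?powR_ge0// ge0_ler_powR ?nnegrE ?addr_ge0 ?sqr_ge0 ?(ltW M0)//; lra.
Unshelve. all: by end_near. Qed.


(** The chain rule applies where the sum of squares is positive. Where it vanishes so do [f 0] and
    [g 0], and the formula gives 0 whatever the power of 0 is. *)
Lemma is_derive_pow_sumsq f g (p f' g' : R) : 1 < p ->
  is_derive (0 : R) (1 : R) f f' -> is_derive (0 : R) (1 : R) g g' ->
  is_derive (0 : R) (1 : R) (fun t => (f t ^+ 2 + g t ^+ 2) `^ (p / 2))
    (p * ((f 0 ^+ 2 + g 0 ^+ 2) `^ (p / 2 - 1) * (f 0 * f' + g 0 * g'))).
Proof.
move=> p1 df dg.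
have [fg0|fg0] := eqVneq (f 0 ^+ 2 + g 0 ^+ 2) 0.
  have /andP[/eqP f0 /eqP g0] : (f 0 == 0) && (g 0 == 0).
    by rewrite -(sqrf_eq0 (f 0)) -(sqrf_eq0 (g 0)) -paddr_eq0 ?sqr_ge0// fg0.
  apply: is_derive_eq; first exact: is_derive_pow_sumsq0 p1 df dg f0 g0.
  by rewrite f0 g0 !mul0r addr0 !mulr0.
have S0 : 0 < f 0 ^+ 2 + g 0 ^+ 2 by rewrite lt_def fg0 addr_ge0 ?sqr_ge0.
pose S : R -> R := f * f + g * g.
have SE t : S t = f t ^+ 2 + g t ^+ 2 by rewrite !expr2.
have dS : is_derive (0 : R) (1 : R) S (f 0 * f' + f 0 * f' + (g 0 * g' + g 0 * g')) :=
  is_deriveD (is_deriveM df df) (is_deriveM dg dg).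
have -> : (fun t => (f t ^+ 2 + g t ^+ 2) `^ (p / 2)) = (fun x : R => x `^ (p / 2)) \o S.
  by apply/funext => t; rewrite /= SE.
rewrite -SE in S0 *.
have := is_derive1_comp (@is_derive1_powR R (p / 2) _ S0) dS.
by move=> /is_derive_eq; apply; field.
Qed.

End DifferentiableNorm.

(** * The differential of the norm *)

Section NormDifferential.
Local Open Scope classical_set_scope.
Variable R : realType.
Implicit Types (x y u m : 'rV[R]_3) (p : R).

Lemma ord3P (P : 'I_3 -> Prop) : P 0 -> P 1 -> P 2 -> forall i, P i.
Proof.
move=> P0 P1 P2 [[|[|[|//]]] i3].
- by rewrite (_ : Ordinal _ = 0)//; apply: val_inj.
- by rewrite (_ : Ordinal _ = 1)//; apply: val_inj.
- by rewrite (_ : Ordinal _ = 2)//; apply: val_inj.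
Qed.

Definition row3 (a b c : R) : 'rV[R]_3 := \row_(i < 3) [:: a; b; c]`_i.

Lemma row3E a b c : (row3 a b c 0 0 = a) * (row3 a b c 0 1 = b) * (row3 a b c 0 2 = c).
Proof. by rewrite !mxE. Qed.

Lemma row3_eta x : x = row3 (x 0 0) (x 0 1) (x 0 2).
Proof. by apply/rowP; apply: ord3P; rewrite row3E. Qed.

Lemma is_derive_row n (u : R -> 'rV[R]_n) (u' : 'rV[R]_n) (t : R) :
  is_derive t (1 : R) u u' <-> forall i, is_derive t (1 : R) (fun s => u s 0 i) (u' 0 i).
Proof.
split=> [[du <-] i|du].
  have dui := (derivable_mxP _ _ _).1 du 0 i.
  by split=> //; rewrite derive_mx// mxE.
have du1 : derivable u t 1.
  by apply/derivable_mxP => i j; rewrite ord1; case: (du j).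
split=> //; rewrite derive_mx//; apply/rowP => i; rewrite mxE.
by case: (du i).
Qed.

(* Up to a positive factor, the derivative at [u] of the norm in the direction [m]; for [p
   < 2] the powers of [0] are junk, but they get multiplied by [0]. *)
Definition norm_diff p u m : R :=
  (u 0 0 ^+ 2 + u 0 1 ^+ 2) `^ (p / 2 - 1) * (u 0 0 * m 0 0 + u 0 1 * m 0 1)
  + (u 0 2 ^+ 2) `^ (p / 2 - 1) * (u 0 2 * m 0 2).

Fact norm_diff_is_linear p u : linear (norm_diff p u : 'rV[R]_3 -> R^o).
Proof. by move=> a m m'; rewrite /norm_diff !mxE /GRing.scale /=; ring. Qed.
HB.instance Definition _ p u := GRing.isLinear.Build R 'rV[R]_3 R^o _
  (norm_diff p u) (norm_diff_is_linear p u).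

Lemma norm_diffZ p u a m : norm_diff p u (a *: m) = a * norm_diff p u m.
Proof. exact: linearZ. Qed.

Lemma norm_diffNN p u m : norm_diff p (- u) (- m) = norm_diff p u m.
Proof. by rewrite /norm_diff !mxE !sqrrN !mulrNN. Qed.

(** The factor [p] of the inner derivatives cancels the exponent [p^-1] of the outer power; [K] is
    the remaining power, of a base that is positive because [u 0 != 0]. *)
Lemma is_derive_l2p_norm p (u : R -> 'rV[R]_3) (u' : 'rV[R]_3) : 1 < p ->
  u 0 != 0 -> is_derive (0 : R) (1 : R) u u' ->
  exists2 K, 0 < K &
    is_derive (0 : R) (1 : R) (fun t => l2p_norm p (u t)) (K * norm_diff p (u 0) u').
Proof.
move=> p1 u0 /is_derive_row du.
have p0 : 0 < p by lra.
pose f t := (u t 0 0 ^+ 2 + u t 0 1 ^+ 2) `^ (p / 2).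
(* Adding a zero square lets the third coordinate reuse the lemma on two squares. *)
pose g t := (u t 0 2 ^+ 2 + 0 ^+ 2) `^ (p / 2).
have df := is_derive_pow_sumsq p1 (du 0) (du 1).
have dg := is_derive_pow_sumsq p1 (du 2) (is_derive_cst (0 : R) (0 : R) (1 : R)).
have absE (z : R) : `|z| `^ p = (z ^+ 2 + 0 ^+ 2) `^ (p / 2).
  rewrite expr0n addr0 -(real_normK (num_real z)) -powR_mulrn// -powRrM.
  by rewrite mulrC divfK ?pnatr_eq0.
have NE t : l2p_norm p (u t) = (f t + g t) `^ p^-1 by rewrite /l2p_norm absE.
have S0 : 0 < f 0 + g 0.
  rewrite lt_def addr_ge0 ?powR_ge0// andbT; apply: contra_neq u0 => /eqP.
  rewrite paddr_eq0 ?powR_ge0// !powR_eq0 => /andP[/andP[+ _] /andP[+ _]].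
  rewrite !paddr_eq0 ?sqr_ge0// !sqrf_eq0 => /andP[/eqP u00 /eqP u01] /andP[/eqP u02 _].
  by apply/rowP; apply: ord3P; rewrite mxE.
exists ((f 0 + g 0) `^ (p^-1 - 1)); first exact: powR_gt0.
have -> : (fun t => l2p_norm p (u t)) = (fun x : R => x `^ p^-1) \o (f + g).
  by apply/funext => t; rewrite NE.
have dfg := is_deriveD df dg.
have := is_derive1_comp (@is_derive1_powR R p^-1 _ (S0 : 0 < (f + g) 0)) dfg.
move=> /is_derive_eq; apply.
rewrite /norm_diff /= [(f + g) 0]/(f 0 + g 0) expr0n addr0 mul0r addr0; field.
by rewrite gt_eqF.
Qed.

Lemma l2p_norm_stationary p (u : R -> 'rV[R]_3) (u' : 'rV[R]_3) : 1 < p ->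
  u 0 != 0 -> is_derive (0 : R) (1 : R) u u' ->
  is_derive (0 : R) (1 : R) (fun t => l2p_norm p (u t)) 0 <-> norm_diff p (u 0) u' = 0.
Proof.
move=> p1 u0 /(is_derive_l2p_norm p1 u0)[K K0 dN]; split => [[_ dN0]|d0].
  by case: dN => _; rewrite dN0 => /esym/eqP; rewrite mulf_eq0 gt_eqF// => /eqP.
by move: dN; rewrite d0 mulr0.
Qed.

End NormDifferential.

(** * Translations and rotations about the third axis *)

Section InfinitesimalRigidMotions.
Local Open Scope classical_set_scope.
Variable R : realType.
Implicit Types (x y u m : 'rV[R]_3) (p : R).

(** The velocity field of the unit-speed rotation about the third axis. *)
Definition spin x : 'rV[R]_3 := row3 (- x 0 1) (x 0 0) 0.

Definition helical (c : 'rV[R]_3) (l : R) x : 'rV[R]_3 := c + l *: spin x.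

Lemma helicalB c l x y : helical c l x - helical c l y = l *: spin (x - y).
Proof.
by apply/rowP; apply: ord3P; rewrite !(mxE, row3E) /=; ring.
Qed.

(** As [helical 0 0] is the zero field, this is the linear independence of the three translations
    and the rotation. *)
Lemma helical_eq0 c l : helical c l = helical 0 0 -> c = 0 /\ l = 0.
Proof.
move=> h0; have h x : helical c l x = 0.
  by rewrite h0 /helical scale0r addr0.
have c0 : c = 0.
  rewrite -[RHS](h 0) /helical; suff -> : spin 0 = 0 :> 'rV[R]_3 by rewrite scaler0 addr0.
  by apply/rowP; apply: ord3P; rewrite row3E !mxE ?oppr0.
split=> //; have /rowP/(_ 1) := h (row3 1 0 0).
by rewrite c0 /helical add0r mxE !row3E mulr1 mxE.
Qed.

Lemma norm_diff_spin p u : norm_diff p u (spin u) = 0.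
Proof. by rewrite /norm_diff !row3E; ring. Qed.

(** Rotate by the angle [l * t] while translating by [t *: c]: differences keep their third
    coordinate and the Euclidean length of their horizontal part, which determine the norm. *)
Lemma helical_inf_rigid_motion p c l :
  inf_rigid_motions (l2p_norm p) (helical c l).
Proof.
pose rot t x := row3 (cos (l * t) * x 0 0 - sin (l * t) * x 0 1)
                     (sin (l * t) * x 0 0 + cos (l * t) * x 0 1) (x 0 2).
have dl (t : R) : is_derive t (1 : R) (fun t : R => l * t) l.
  have /is_derive_eq := is_deriveZ l (is_derive_id t (1 : R)); apply.
  by rewrite /GRing.scale /= mulr1.
have dcos (t : R) : is_derive t (1 : R) (fun t => cos (l * t)) (- sin (l * t) * l).
  exact: (is_derive1_comp (is_derive_cos (l * t)) (dl t)).
have dsin (t : R) : is_derive t (1 : R) (fun t => sin (l * t)) (cos (l * t) * l).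
  exact: (is_derive1_comp (is_derive_sin (l * t)) (dl t)).
have dmul (f : R -> R) (t f' a : R) : is_derive t (1 : R) f f' ->
    is_derive t (1 : R) (fun t => f t * a) (f' * a).
  move=> df; have := is_deriveZ a df.
  rewrite (_ : a \*: f = fun t => f t * a); last by apply/funext => s; rewrite [LHS]mulrC.
  by move=> /is_derive_eq; apply; rewrite [LHS]mulrC.
(* The derivative is taken at every [t], since continuity of the paths will follow from it. *)
have dalpha x t : is_derive t (1 : R) (fun t => t *: c + rot t x)
    (c + row3 (- sin (l * t) * l * x 0 0 - cos (l * t) * l * x 0 1)
              (cos (l * t) * l * x 0 0 + - sin (l * t) * l * x 0 1) 0).
  have dc i : is_derive t (1 : R) (fun t : R => t * c 0 i) (c 0 i).
    have /is_derive_eq := dmul _ _ _ (c 0 i) (is_derive_id t (1 : R)); apply.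
    by rewrite mul1r.
  apply/is_derive_row; apply: ord3P; rewrite mxE row3E.
  - have := is_deriveD (dc 0) (is_deriveB (dmul _ _ _ (x 0 0) (dcos t))
      (dmul _ _ _ (x 0 1) (dsin t))).
    by congr is_derive; apply/funext => s; rewrite mxE row3E mxE.
  - have := is_deriveD (dc 1) (is_deriveD (dmul _ _ _ (x 0 0) (dsin t))
      (dmul _ _ _ (x 0 1) (dcos t))).
    by congr is_derive; apply/funext => s; rewrite mxE row3E mxE.
  - have := is_deriveD (dc 2) (is_derive_cst (x 0 2 : R) t (1 : R)).
    by congr is_derive; apply/funext => s; rewrite mxE row3E mxE.
exists (fun x t => t *: c + rot t x); first split.
- by move=> x; apply: derivable_within_continuous => t _; case: (dalpha x t).
- move=> x; rewrite scale0r add0r /rot mulr0 cos0 sin0.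
  by rewrite [RHS]row3_eta; congr row3; ring.
- move=> x y t _; set d := (X in l2p_norm p X = _).
  have d2 : d 0 2 = (x - y) 0 2 by rewrite /d !(mxE, row3E) /=; ring.
  have d01 : d 0 0 ^+ 2 + d 0 1 ^+ 2 = (x - y) 0 0 ^+ 2 + (x - y) 0 1 ^+ 2.
    rewrite -[RHS]mul1r -(cos2Dsin2 (l * t)) /d !(mxE, row3E) /=; ring.
  by rewrite /l2p_norm d2 d01.
- move=> x; have /is_derive_eq := dalpha x 0; apply.
  rewrite /helical mulr0 cos0 sin0; congr (_ + _).
  by apply/rowP; apply: ord3P; rewrite !(mxE, row3E) /=; ring.
Qed.

(** The distance between two moving points is constant for [t] near 0, so its derivative there
    vanishes. *)
Lemma inf_rigid_motion_norm_diff p (eta : 'rV[R]_3 -> 'rV[R]_3) : 1 < p ->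
  inf_rigid_motions (l2p_norm p) eta ->
  forall x y, x <> y -> norm_diff p (x - y) (eta x - eta y) = 0.
Proof.
move=> p1 [alpha [_ alpha0 alphaN] dalpha] x y xy.
have d := is_deriveB (dalpha x) (dalpha y).
have := @l2p_norm_stationary R p (alpha x - alpha y) (eta x - eta y) p1.
rewrite [(alpha x - alpha y) 0]/(alpha x 0 - alpha y 0) !alpha0 subr_eq0 => H.
apply/(H _ d); first exact/eqP.
have near_cst : \forall t \near (0 : R), cst (l2p_norm p (x - y)) t =
    l2p_norm p ((alpha x - alpha y) t).
  near=> t; rewrite -(alphaN x y t)// in_itv /= -ler_norml.
  near: t; exact: (@nbhs0_le _ R^o 1 ltr01).
apply: near_eq_is_derive near_cst (is_derive_cst _ _ _).
Unshelve. all: by end_near. Qed.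

End InfinitesimalRigidMotions.

(** * Classification of the infinitesimal rigid motions *)

Section Classification.
Variable R : realType.

(** Vertical pairs make the third component independent of the height; horizontal pairs make the
    other two a planar translation plus rotation at each height. Slanted pairs then remove the
    dependence on the height. *)
Lemma inf_isometry_helical (p : R) (eta : 'rV[R]_3 -> 'rV[R]_3) : p <> 2 ->
  (forall x y, x <> y -> norm_diff p (x - y) (eta x - eta y) = 0) ->
  exists c l, eta = helical c l.
Proof.
move=> p2 eta_iso.
pose w (s : R) := s `^ (p / 2 - 1).
have w_gt0 s : 0 < s -> 0 < w s by exact: powR_gt0.
have w1 : w 1 = 1 by rewrite /w powR1.
(* Here [w 4] is $2^{p-2}$; this is where $p \neq 2$ enters. *)
have w4 : w 4 != 1.
  rewrite /w powR_eq1 !negb_or; apply/and3P; split.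
  - by rewrite gt_eqF//; lra.
  - by rewrite -leNgt; lra.
  - by apply/eqP => h; apply: p2; lra.
pose F1 x y z := eta (row3 x y z) 0 0.
pose F2 x y z := eta (row3 x y z) 0 1.
pose F3 x y z := eta (row3 x y z) 0 2.
have H x y z x' y' z' : x != x' \/ y != y' \/ z != z' ->
    w ((x - x') ^+ 2 + (y - y') ^+ 2) *
      ((x - x') * (F1 x y z - F1 x' y' z') + (y - y') * (F2 x y z - F2 x' y' z'))
    + w ((z - z') ^+ 2) * ((z - z') * (F3 x y z - F3 x' y' z')) = 0.
  move=> neq; have xx' : row3 x y z <> row3 x' y' z'.
    move=> /rowP h; have := h 0; have := h 1; have := h 2.
    by rewrite !row3E => ez ey ex; move: neq; rewrite ex ey ez !eqxx => -[|[]].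
  by have := eta_iso _ _ xx'; rewrite /norm_diff !(mxE, row3E) /=.
have vertical x y z z' : F3 x y z = F3 x y z'.
  have [->//|zz'] := eqVneq z z'.
  have := H x y z x y z' (or_intror (or_intror zz')).
  rewrite !subrr !mul0r addr0 mulr0 add0r => /eqP.
  have zz0 : 0 < (z - z') ^+ 2 by rewrite exprn_even_gt0//= subr_eq0.
  by rewrite !mulf_eq0 gt_eqF ?w_gt0//= subr_eq0 (negbTE zz')/= subr_eq0 => /eqP.
have horizontal x y x' y' z :
    (x - x') * (F1 x y z - F1 x' y' z) + (y - y') * (F2 x y z - F2 x' y' z) = 0.
  have [/andP[/eqP-> /eqP->]|] := boolP ((x == x') && (y == y')).
    by rewrite !subrr !mul0r addr0.
  rewrite negb_and => /orP xy; have neq : x != x' \/ y != y' \/ z != z by tauto.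
  have := H _ _ _ _ _ _ neq; rewrite [z - z]subrr mul0r mulr0 addr0 => /eqP.
  rewrite mulf_eq0 gt_eqF ?w_gt0//= => [/eqP//|].
  rewrite lt_def addr_ge0 ?sqr_ge0// andbT paddr_eq0 ?sqr_ge0//.
  by rewrite !sqrf_eq0 !subr_eq0 negb_and; apply/orP.
pose l z := F2 1 0 z - F2 0 0 z.
(* Subtracting [h0] from [h1] and from [h2] cancels the products of coordinates with values at
   [(x, y)]. *)
have planar x y z :
    (F1 x y z = F1 0 0 z - l z * y) * (F2 x y z = F2 0 0 z + l z * x).
  have h0 := horizontal x y 0 0 z.
  have h1 := horizontal x y 1 0 z.
  have h2 := horizontal x y 0 1 z.
  have h3 := horizontal 1 0 0 0 z.
  have h4 := horizontal 0 1 0 0 z.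
  have h5 := horizontal 1 0 0 1 z.
  rewrite /l.
  have e1 : F1 1 0 z = F1 0 0 z by lra.
  have e2 : F2 0 1 z = F2 0 0 z by lra.
  have e3 : F1 0 1 z = F1 0 0 z - (F2 1 0 z - F2 0 0 z) by lra.
  by rewrite e1 in h1; rewrite e2 e3 in h2; split; lra.
(* This compares [(x, y, z)] with the origin; the rotation part is orthogonal to [(x, y)] and drops
   out. *)
have shift x y z : z != 0 ->
   w (x ^+ 2 + y ^+ 2) * (x * (F1 0 0 z - F1 0 0 0) + y * (F2 0 0 z - F2 0 0 0))
   + w (z ^+ 2) * (z * (F3 x y z - F3 0 0 z)) = 0.
  move=> z0; have := H x y z 0 0 0 (or_intror (or_intror z0)).
  rewrite !subr0 !(planar x y z) (vertical 0 0 z 0) => h; rewrite -[RHS]h.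
  congr (_ * _ + _); ring.
(* The increments from [0] to [(x, y)] and from [(x, y)] to [(2x, 2y)] are equal, but
   their sum scales like [2 `^ (p - 1)]. *)
have doubling x y z : z != 0 -> 0 < x ^+ 2 + y ^+ 2 ->
    x * (F1 0 0 z - F1 0 0 0) + y * (F2 0 0 z - F2 0 0 0) = 0.
  move=> z0 xy0.
  have s1 := shift x y z z0; have s2 := shift (2 * x) (2 * y) z z0.
  have := H (2 * x) (2 * y) z x y 0 (or_intror (or_intror z0)).
  rewrite !(planar (2 * x) (2 * y) z) !(planar x y 0) subr0 (vertical x y 0 z).
  rewrite (_ : 2 * x - x = x); last by ring.
  rewrite (_ : 2 * y - y = y); last by ring.
  rewrite (_ : (2 * x) ^+ 2 + (2 * y) ^+ 2 = 4 * (x ^+ 2 + y ^+ 2)) in s2; last by ring.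
  have wM : w (4 * (x ^+ 2 + y ^+ 2)) = w 4 * w (x ^+ 2 + y ^+ 2).
    by rewrite /w powRM// ltW.
  rewrite wM in s2 => s3.
  (* This is half of [s2 - s1 - s3]: all three pairs differ by [z] in height, so the terms in [F3]
     telescope. *)
  have /eqP : (w 4 - 1) * (w (x ^+ 2 + y ^+ 2) *
     (x * (F1 0 0 z - F1 0 0 0) + y * (F2 0 0 z - F2 0 0 0))) = 0 by lra.
  by rewrite !mulf_eq0 subr_eq0 (negbTE w4) gt_eqF ?w_gt0//= => /eqP.
have C1 z : F1 0 0 z = F1 0 0 0.
  have [->//|z0] := eqVneq z 0; have := doubling 1 0 z z0.
  by rewrite expr1n expr0n addr0 ltr01 => /(_ isT); lra.
have C2 z : F2 0 0 z = F2 0 0 0.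
  have [->//|z0] := eqVneq z 0; have := doubling 0 1 z z0.
  by rewrite expr1n expr0n add0r ltr01 => /(_ isT); lra.
have F3_cst x y z : F3 x y z = F3 0 0 0.
  (* Both heights are moved to 1 because [shift] requires a nonzero height. *)
  rewrite (vertical x y z 1) (vertical 0 0 0 1).
  have := shift x y 1 (oner_neq0 _).
  by rewrite C1 C2 !subrr !mulr0 addr0 mulr0 add0r expr1n w1; lra.
have l_cst z : l z = l 0.
  have [->//|z0] := eqVneq z 0.
  (* Along this pair the first component changes by [l 0] and the second by [l z], with opposite
     coefficients. *)
  have := H 1 0 z 0 1 0 (or_intror (or_intror z0)).
  rewrite !F3_cst subrr !mulr0 addr0 !(planar 1 0 z) !(planar 0 1 0) C1 C2.
  move=> /eqP; rewrite mulf_eq0 gt_eqF; first by move=> /eqP; lra.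
  by apply: w_gt0; lra.
exists (row3 (F1 0 0 0) (F2 0 0 0) (F3 0 0 0)), (l 0); apply/funext => x.
rewrite [x]row3_eta; set a := x 0 0; set b := x 0 1; set c := x 0 2.
apply/rowP; apply: ord3P; rewrite !(mxE, row3E) /=.
- by rewrite -/(F1 a b c) (planar a b c).1 C1 l_cst; ring.
- by rewrite -/(F2 a b c) (planar a b c).2 C2 l_cst.
- by rewrite -/(F3 a b c) F3_cst; ring.
Qed.

End Classification.

(** * Flexes and the two edge counts *)

Section EdgeCount.
Variables (R : realType) (p : R) (V : finType).
Hypotheses (p1 : 1 < p) (p2 : p <> 2).
Variables (E : {set {set V}}) (q : V -> 'rV[R]_3).
Hypothesis hfw : framework E q.

Lemma inf_rigid_motionsP (eta : 'rV[R]_3 -> 'rV[R]_3) :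
  inf_rigid_motions (l2p_norm p) eta <-> exists c l, eta = helical c l.
Proof.
split=> [/(inf_rigid_motion_norm_diff p1)|[c [l ->]]].
  exact: inf_isometry_helical.
exact: helical_inf_rigid_motion.
Qed.

Lemma inf_flexP (E' : {set {set V}}) (m : V -> 'rV[R]_3) : E' \subset E ->
  inf_flex (l2p_norm p) E' q m <->
  forall v w, [set v; w]%SET \in E' -> norm_diff p (q v - q w) (m v - m w) = 0.
Proof.
move=> sE'; suff H v w : [set v; w]%SET \in E' ->
    is_derive (0 : R) (1 : R)
      (fun t : R => l2p_norm p ((q v + t *: m v) - (q w + t *: m w))) 0 <->
    norm_diff p (q v - q w) (m v - m w) = 0.
  by split=> h v w vw; apply/(H _ _ vw)/h.
move=> vw; pose u (t : R) := (q v - q w) + t *: (m v - m w).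
have -> : (fun t : R => l2p_norm p ((q v + t *: m v) - (q w + t *: m w))) =
    (fun t => l2p_norm p (u t)).
  by apply/funext => t; rewrite /u scalerBr opprD addrACA.
have u0 : u 0 = q v - q w by rewrite /u scale0r addr0.
rewrite -u0; apply: l2p_norm_stationary => //.
  by rewrite u0 subr_eq0; apply/eqP/(hfw.2 v w)/(fintype.subsetP sE').
apply/is_derive_row => i.
have := is_deriveD (is_derive_cst ((q v - q w) 0 i) (0 : R) (1 : R))
  (is_deriveZ ((m v - m w) 0 i) (is_derive_id (0 : R) (1 : R))).
move=> /is_derive_eq /(_ _); rewrite add0r [_ *: 1]mulr1 => /(_ _ erefl).
congr is_derive; apply/funext => t.
by rewrite /u [RHS]mxE [X in _ = _ + X]mxE [X in _ = _ + X]mulrC.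
Qed.

(** Edges are unordered, while the equations below need an ordered pair for each edge. *)
Lemma edge_endpoints : exists ab : {e | e \in E} -> V * V,
  forall e, sval e = [set (ab e).1; (ab e).2]%SET.
Proof.
have ex (e : {e | e \in E}) : exists ab : V * V, sval e = [set ab.1; ab.2]%SET.
  case: e => e eE; have /eqP/cards2P[a [b [_ eab]]] := hfw.1 e eE.
  by exists (a, b).
by have [ab abE] := choice ex; exists ab.
Qed.

Lemma norm_diff_edge (m : V -> 'rV[R]_3) v w a b :
  [set v; w]%SET = [set a; b]%SET ->
  norm_diff p (q v - q w) (m v - m w) = norm_diff p (q a - q b) (m a - m b).
Proof.
move=> vwab.
have [[-> ->]//|[-> ->]] : (v = a /\ w = b) \/ (v = b /\ w = a).
  have : v \in [set a; b]%SET by rewrite -vwab set21.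
  have : w \in [set a; b]%SET by rewrite -vwab set22.
  have : a \in [set v; w]%SET by rewrite vwab set21.
  have : b \in [set v; w]%SET by rewrite vwab set22.
  rewrite !inE => /orP[]/eqP ? /orP[]/eqP ? /orP[]/eqP ? /orP[]/eqP ?; subst; tauto.
by rewrite -norm_diffNN !opprB.
Qed.

(** A flex has [3 * #|V|] coordinates and satisfies one equation per edge; by rigidity the solutions
    are spanned by four trivial flexes. *)
Lemma inf_rigid_card_geq : inf_rigid (l2p_norm p) E q -> (3 * #|V| <= #|E| + 4)%N.
Proof.
move=> rigid; have [ab abE] := edge_endpoints.
(* [d] is the flex that moves the single vertex [vi.1] in the direction [vi.2], and [A] is the
   transposed rigidity matrix, up to positive scaling of the equations. *)
pose d (v : V) (vi : V * 'I_3) : 'rV[R]_3 := (v == vi.1)%:R *: delta_mx 0 vi.2.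
pose A (vi : V * 'I_3) (e : {e | e \in E}) :=
  norm_diff p (q (ab e).1 - q (ab e).2) (d (ab e).1 vi - d (ab e).2 vi).
pose B (k : 'I_3 + 'I_1) (vi : V * 'I_3) : R :=
  (match k with inl k => delta_mx 0 k | inr _ => spin (q vi.1) end : 'rV_3) 0 vi.2.
have := @solutions_span_leq R _ _ _ A B.
rewrite card_prod card_sum !card_ord card_sig mulnC; apply => x xA.
pose m v : 'rV[R]_3 := \row_i x (v, i).
have mE v : m v = \sum_vi x vi *: d v vi.
  rewrite (eq_bigr (fun vi => x (vi.1, vi.2) *: d v (vi.1, vi.2))); last by case.
  rewrite -(pair_bigA _ (fun w i => x (w, i) *: d v (w, i))) (bigD1 v)//=.
  rewrite [X in _ + X]big1 ?addr0 => [|w wv].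
    rewrite [LHS]row_sum_delta; apply: eq_bigr => i _.
    by rewrite /d eqxx scale1r mxE.
  by apply: big1 => i _; rewrite /d eq_sym (negbTE wv) scale0r scaler0.
have mflex : inf_flex (l2p_norm p) E q m.
  apply/inf_flexP => // v w vw.
  pose e : {e | e \in E} := exist (fun e => e \in E) _ vw.
  have nd0 : norm_diff p (q (ab e).1 - q (ab e).2) (m (ab e).1 - m (ab e).2) = 0.
    rewrite -[RHS](xA e) !mE -sumrB raddf_sum; apply: eq_bigr => vi _.
    by rewrite -scalerBr /= norm_diffZ.
  by rewrite -[RHS]nd0; apply: norm_diff_edge; rewrite -abE.
have [_ /inf_rigid_motionsP[c [l ->]] mcl] := rigid m mflex.
exists (fun k => match k with inl k => c 0 k | inr _ => l end) => -[v i].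
have <- : m v 0 i = x (v, i) by rewrite mxE.
rewrite mcl /B big_sumType big_ord1 /= mxE [X in _ + X]mxE; congr (_ + _).
rewrite [in LHS](row_sum_delta c) summxE.
by apply: eq_bigr => k _; rewrite mxE.
Qed.

(** A nontrivial flex of the graph without [e] cannot preserve [e] to first order, or rigidity would
    make it trivial. *)
Lemma minimal_edge_witness e :
  inf_rigid (l2p_norm p) E q -> ~ inf_rigid (l2p_norm p) (E :\ e)%SET q ->
  exists m : V -> 'rV[R]_3, forall v w, [set v; w]%SET \in E ->
    ([set v; w]%SET != e <-> norm_diff p (q v - q w) (m v - m w) = 0).
Proof.
move=> rigid /existsNP[m /not_implyP[mflex mNtriv]].
have /inf_flexP := mflex => /(_ (subD1set _ _)) mD.
exists m => v w vwE; split=> [vwe|vw0]; first by apply: mD; rewrite !inE vwe.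
apply/eqP => vwe; apply: mNtriv; apply: rigid; apply/inf_flexP => // a b abE.
have [abe|abNe] := eqVneq [set a; b]%SET e; last by apply: mD; rewrite !inE abNe.
by rewrite -[RHS]vw0; apply: norm_diff_edge; rewrite abe.
Qed.

Lemma minimal_card_leq (W : {set V}) (F : {set {set V}}) :
  inf_rigid (l2p_norm p) E q ->
  (forall e, e \in E -> ~ inf_rigid (l2p_norm p) (E :\ e)%SET q) ->
  subgraph E W F -> full_set (l2p_norm p) (q @` [set` W])%classic ->
  (#|F| + 4 <= 3 * #|W|)%N.
Proof.
move=> rigid minimal [sFE sFW] Wfull; have [ab abE] := edge_endpoints.
have wit (e : {e | e \in F}) : exists m : V -> 'rV[R]_3,
    forall v w, [set v; w]%SET \in E ->
      ([set v; w]%SET != sval e <-> norm_diff p (q v - q w) (m v - m w) = 0).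
  apply: minimal_edge_witness => //; apply: minimal.
  exact: (fintype.subsetP sFE) (svalP e).
have {wit}[mm mmP] := choice wit.
pose A (i : {e | e \in F} + ('I_3 + 'I_1)) (vj : {v | v \in W} * 'I_3) : R :=
  (match i with
  | inl e => mm e (sval vj.1)
  | inr (inl k) => delta_mx 0 k
  | inr (inr _) => spin (q (sval vj.1))
  end : 'rV_3) 0 vj.2.
(* With an empty spanning family it remains to see that a linear relation among the [#|F| + 4]
   fields restricted to [W] is zero. *)
have := @solutions_span_leq R _ _ 'I_0 A (fun _ _ => 0).
rewrite !card_sum card_prod !card_sig !card_ord addn0 mulnC; apply => x xA.
suff x0 i : x i = 0 by exists (fun=> 0) => i; rewrite x0 big_ord0.
pose c : 'rV[R]_3 := \row_k x (inr (inl k)).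
pose l := x (inr (inr ord0)).
pose s v := \sum_(e : {e | e \in F}) x (inl e) *: mm e v.
have sW v : v \in W -> s v + helical c l (q v) = 0.
  move=> vW; apply/rowP => j; rewrite [RHS]mxE.
  rewrite -[RHS](xA (exist (fun v => v \in W) v vW, j)).
  rewrite !big_sumType big_ord1 /= !mxE -/l; congr (_ + (_ + _)); last by rewrite /A mxE.
    by rewrite summxE; apply: eq_bigr => e _; rewrite mxE.
  rewrite (bigD1 j)//= /A /= big1 ?addr0 => [|k kj]; first by rewrite !mxE !eqxx mulr1.
  by rewrite mxE eq_sym (negbTE kj) andbF mulr0.
(* On the edge [e], whose ends lie in [W], the trivial part and the witnesses of the other edges
   contribute 0, so only the coefficient of [e] times a nonzero number is left. *)
have xE (e : {e | e \in F}) : x (inl e) = 0.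
  have eE := fintype.subsetP sFE _ (svalP e).
  have := abE (exist (fun e => e \in E) _ eE) => /=; set a := _.1; set b := _.2 => eab.
  have [aW bW] : a \in W /\ b \in W.
    have /fintype.subsetP eW := sFW _ (svalP e).
    by split; apply: eW; rewrite eab ?set21 ?set22.
  have : norm_diff p (q a - q b) (s a - s b) = 0.
    have -> : s a - s b = - l *: spin (q a - q b).
      rewrite scaleNr -(helicalB c) opprB.
      move/eqP: (sW _ aW); rewrite addr_eq0 => /eqP->.
      by move/eqP: (sW _ bW); rewrite addr_eq0 => /eqP->; rewrite opprK addrC.
    by rewrite norm_diffZ norm_diff_spin mulr0.
  rewrite /s -sumrB raddf_sum (bigD1 e)//= big1 ?addr0 => [|f fe]; last first.
    rewrite -scalerBr norm_diffZ (mmP f a b _).1 ?mulr0// -?eab//.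
    by rewrite eq_sym (inj_eq val_inj).
  rewrite -scalerBr norm_diffZ => /eqP; rewrite mulf_eq0 => /orP[/eqP//|/eqP].
  by rewrite -(mmP e a b) -?eab// eqxx.
(* The trivial part now vanishes at the points of [W], hence everywhere by fullness. *)
have h0 : helical c l = helical 0 0.
  apply: Wfull; [exact: helical_inf_rigid_motion..|].
  move=> _ [v vW <-]; rewrite [RHS]/helical scale0r addr0 -[RHS](sW v vW).
  by rewrite /s big1 ?add0r// => e _; rewrite xE scale0r.
have [c0 l0] := helical_eq0 h0.
case: i => [e|[k|k]]; rewrite ?xE//.
  by move/rowP/(_ k): c0; rewrite !mxE.
by rewrite ord1.
Qed.

End EdgeCount.

(** * Small vertex sets and tightness *)

Lemma card_edges_le_bin (V : finType) (E F : {set {set V}}) (W : {set V}) :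
  simple_graph E -> subgraph E W F -> (#|F| <= 'C(#|W|, 2))%N.
Proof.
move=> simple [sFE sFW]; rewrite -cards_draws.
apply/subset_leq_card/fintype.subsetP => e eF.
by rewrite inE sFW//= simple// (fintype.subsetP sFE).
Qed.

Theorem theorem6p14 (R : realType) (p : R) (hp1 : 1 < p) (hp2 : p <> 2)
    (V : finType) (hV : (6 <= #|V|)%N)
    (E : {set {set V}}) (q : V -> 'rV[R]_3)
    (hfw : framework E q)
    (hrigid : inf_rigid (l2p_norm p) E q)
    (hfull : completely_full (l2p_norm p) E q)
    (hmin : forall e : {set V}, e \in E ->
       ~ inf_rigid (l2p_norm p) (E :\ e)%SET q) :
  tight34 E.

Proof.
have upper W F : subgraph E W F -> (6 <= #|W|)%N -> (#|F| + 4 <= 3 * #|W|)%N.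
  by move=> sF W6; apply: (minimal_card_leq hp1 hfw hrigid hmin sF); exact: hfull.2 sF W6.
split.
  apply/eqP; rewrite eqn_leq (inf_rigid_card_geq hp1 hp2 hfw hrigid) andbT -cardsT.
  by apply: upper; [split=> // e _; exact: finset.subsetT|rewrite cardsT].
move=> W F sF F0; have [/(upper _ _ sF)//|] := leqP 6 #|W|.
have := card_edges_le_bin hfw.1 sF.
(* For [#|W|] equal to 2, 3, 4, 5 there are at most 1, 3, 6, 10 edges, against the bounds 2, 5, 8,
   11; fewer vertices leave no edge. *)
move: #|W| => [|[|[|[|[|[|//]]]]]] + _; rewrite ?bin0n ?bin1n ?leqn0.
all: by move: #|F| F0 => [|[|[|[|[|[|[|[|[|[|[|]]]]]]]]]]].
Qed.
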